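(* Let $r,\ell\ge 0$ be integers, let $P=\mathsf{k}[x_R,x_L,y_1,\dots,y_r,z_1,\dots,z_\ell]$ be a standard graded polynomial ring over a field $\mathsf{k}$, and let $I(\mathcal{W}_{r,\ell})\subseteq P$ be the edge ideal of the whisker graph $\mathcal{W}_{r,\ell}$. Then for each integer $k\ge 1$ the projective dimension of $I(\mathcal{W}_{r,\ell})^k$ is $$\mathrm{pd}\big(I(\mathcal{W}_{r,\ell})^k\big)=\begin{cases} r+\ell, & k\ge 2,\\ \max(r,\ell), & k=1,\end{cases}$$ and its Betti numbers are $$\beta_i\big(I(\mathcal{W}_{r,\ell})^k\big)=\begin{cases}\displaystyle \binom{k-2+i}{i}\binom{r+\ell+k}{k+i}+\binom{k-2+i}{i-1}\left[\binom{r+k}{k+i}+\binom{\ell+k}{k+i}\right], & i\ge 1,\\[2ex] \displaystyle\binom{r+\ell+k}{k}, & i=0.\end{cases}$$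
   Context: The whisker graph $\mathcal{W}_{r,\ell}$ is the simple graph with the $r+\ell+2$ vertices $x_R,x_L,y_1,\dots,y_r,z_1,\dots,z_\ell$ and the $r+\ell+1$ edges $\{x_R,x_L\}$, $\{x_R,y_i\}$ for $1\le i\le r$, and $\{x_L,z_j\}$ for $1\le j\le \ell$. Its edge ideal is $I(\mathcal{W}_{r,\ell})=(x_Rx_L,\ x_Ry_1,\dots,x_Ry_r,\ x_Lz_1,\dots,x_Lz_\ell)$. Here $\mathrm{pd}(I)$ and $\beta_i(I)$ denote the projective dimension and the $i$-th (total) Betti number of the ideal $I$ regarded as a $P$-module; thus $\beta_i(I)$ is the rank of the $i$-th free module in the minimal graded free resolution of $I$ over $P$, and $\beta_0(I)$ is the minimal number of generators of $I$. Binomial coefficients $\binom{a}{b}$ with $0\le a<b$ are $0$. *)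

(* Defs.v *)
From HB Require Import structures.
From mathcomp Require Import all_boot all_order all_algebra.
From mathcomp Require Import mpoly.

Set Implicit Arguments.
Unset Strict Implicit.
Unset Printing Implicit Defensive.

Import GRing.Theory.
Local Open Scope ring_scope.

Section Ideals.
Variable R : comNzRingType.

Definition ideal_gen (S : R -> Prop) : R -> Prop := fun f =>
  exists s : seq (R * R),
    (forall cg, cg \in s -> S cg.2) /\ f = \sum_(cg <- s) cg.1 * cg.2.

Definition ideal_mul (I J : R -> Prop) : R -> Prop :=
  ideal_gen (fun h => exists f g, [/\ I f, J g & h = f * g]).

Fixpoint ideal_pow (I : R -> Prop) (k : nat) : R -> Prop :=
  if k is k'.+1 then ideal_mul I (ideal_pow I k') else fun _ => True.

End Ideals.

Definition exact_at (A B : Type) (C : zmodType) (f : A -> B) (g : B -> C) :=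
  forall y : B, g y = 0 <-> exists x : A, f x = y.

Section ProjectiveDimension.
Variable R : comNzRingType.

Definition projective (M : lmodType R) : Prop :=
  forall (N N' : lmodType R) (g : {linear N -> N'}) (f : {linear M -> N'}),
    (forall y, exists x, g x = y) ->
    exists h : {linear M -> N}, forall x, g (h x) = f x.

(* Exactness of 0 -> M_n -> ... -> M_0 -> I -> 0; the surjection M_0 -> I is  *)
(* given as a linear map to R with image I, so that I needs no module type    *)
(* of its own.                                                                *)
Definition has_projective_resolution (I : R -> Prop) (n : nat) : Prop :=
  exists (M : nat -> lmodType R) (d : forall i, {linear M i.+1 -> M i})
         (eps : {linear M 0%N -> R^o}),
    [/\ forall i, projective (M i),
        forall i, (n < i)%N -> forall x : M i, x = 0,
        forall f : R, I f <-> exists x, eps x = f,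
        exact_at (d 0%N) eps &
        forall i, exact_at (d i.+1) (d i)].

(* For I <> 0 only: the zero module also gets 0 here.                         *)
Definition is_pd (I : R -> Prop) (n : nat) : Prop :=
  has_projective_resolution I n /\
  forall m, has_projective_resolution I m -> (n <= m)%N.

End ProjectiveDimension.

Section BettiNumbers.
Variables (K : fieldType) (n : nat).
Local Notation P := {mpoly K[n]}.

Definition homog_of_degree (d : int) (p : P) : Prop :=
  if d is Posz m then p \is m.-homog else p = 0.

Definition irrelevant_ideal : P -> Prop :=
  ideal_gen (fun f => exists i : 'I_n, f = 'X_i).

(* F_i is the direct sum of the P(- gc_deg i j), with row vectors as          *)
(* elements; the matrices act by multiplication on the right.                 *)
Record graded_free_complex := GradedFreeComplex {
  gc_rank : nat -> nat;
  gc_deg : forall i, 'I_(gc_rank i) -> int;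
  gc_diff : forall i, 'M[P]_(gc_rank i.+1, gc_rank i);
  gc_aug : 'cV[P]_(gc_rank 0%N);
  gc_diff_homog : forall i (a : 'I_(gc_rank i.+1)) (b : 'I_(gc_rank i)),
    homog_of_degree (gc_deg a - gc_deg b) (gc_diff i a b);
  gc_aug_homog : forall a : 'I_(gc_rank 0%N),
    homog_of_degree (gc_deg a) (gc_aug a 0)
}.

Definition is_resolution (I : P -> Prop) (F : graded_free_complex) : Prop :=
  [/\ forall f : P, I f <-> exists v : 'rV[P]_(gc_rank F 0%N),
                              (v *m gc_aug F) 0 0 = f,
      exact_at (fun v : 'rV_(_) => v *m gc_diff F 0%N)
               (fun v : 'rV_(_) => v *m gc_aug F) &
      forall i, exact_at (fun v : 'rV_(_) => v *m gc_diff F i.+1)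
                         (fun v : 'rV_(_) => v *m gc_diff F i)].

Definition is_minimal (F : graded_free_complex) : Prop :=
  forall i a b, irrelevant_ideal (gc_diff F i a b).

(* The first conjunct makes the Betti numbers exist, the second makes them    *)
(* independent of the chosen minimal resolution.                              *)
Definition is_betti (I : P -> Prop) (beta : nat -> nat) : Prop :=
  (exists F, is_resolution I F /\ is_minimal F) /\
  forall F, is_resolution I F -> is_minimal F ->
    forall i, gc_rank F i = beta i.

End BettiNumbers.

Record simple_graph (V : Type) := SimpleGraph {
  adj :> rel V;
  adj_sym : forall u v, adj u v = adj v u;
  adj_irr : forall u, adj u u = false
}.

Definition edge_ideal (K : fieldType) (n : nat) (G : simple_graph 'I_n) :
    {mpoly K[n]} -> Prop :=
  ideal_gen (fun f => exists u v, G u v /\ f = 'X_u * 'X_v).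

Arguments edge_ideal K {n} G.

Section Whisker.
Variables r l : nat.
Local Notation V := 'I_(2 + (r + l)).

Definition wh_xR : V := lshift (r + l) ord0.
Definition wh_xL : V := lshift (r + l) ord_max.
Definition wh_y (i : 'I_r) : V := rshift 2 (lshift l i).
Definition wh_z (j : 'I_l) : V := rshift 2 (rshift r j).

Definition wh_arc : rel V := fun u v =>
  [|| (u == wh_xR) && (v == wh_xL),
      (u == wh_xR) && [exists i, v == wh_y i] |
      (u == wh_xL) && [exists j, v == wh_z j]].

Definition wh_adj : rel V := fun u v => wh_arc u v || wh_arc v u.

Lemma wh_adj_sym u v : wh_adj u v = wh_adj v u.
Proof. by rewrite /wh_adj orbC. Qed.

Lemma wh_adj_irr u : wh_adj u u = false.
Proof.
rewrite /wh_adj orbb; apply/negP.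
by case/or3P=> /andP[/eqP-> ];
   [|case/existsP=> i|case/existsP=> i]; rewrite -val_eqE.
Qed.

Definition whisker : simple_graph V := SimpleGraph wh_adj_sym wh_adj_irr.

End Whisker.

(* Main.v *)
Require Import Defs.
From HB Require Import structures.
From mathcomp Require Import all_boot all_order all_algebra.
From mathcomp Require Import mpoly zify ring.
From Stdlib Require Import ClassicalEpsilon FunctionalExtensionality.

(** Both parts of the theorem can be read off one minimal graded free resolution
of I(W)^k: by the comparison theorem, a minimal resolution F and any projective
resolution N of the same ideal are linked by maps phi : F_i -> N_i and
psi : N_i -> F_i whose composite on F_i is the identity up to a homotopy.  The
homotopy terms factor through the differentials of F, so they vanish modulo the
irrelevant ideal, and F_i becomes a retract of N_i there.  Hence rank F_i is an
invariant of the ideal ([minimal_rank_leq]), and N_p = 0 is impossible as long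
as F_p is nonzero ([minimal_resolution_pd]).

The resolution exists because I(W)^k has linear quotients.  If J is generated in
degree d and has a linear resolution, u is a form of degree d, and J : u has a
linear resolution generated by linear forms, then the mapping cone of a lift of
multiplication by u is a linear resolution of J + (u)
([lin_res_add_generator]); minimality is automatic, as all entries of the
differentials are linear forms.  Iterating this adds 'C(q, i) to the i-th rank
each time the colon ideal is generated by q variables ([linear_quotients]); the
resolution of an ideal of variables, which is the Koszul complex, is itself
obtained by the same step.

Let y-leaves be the neighbours of x_R and z-leaves those of x_L.  A product of k
edges is determined by the exponents g of the leaves: with A the y-degree and B
the z-degree of g, where A + B <= k, it is x_R^(k-B) x_L^(k-A) times the leaf
monomial of g.  List the g by degree, then lexicographically.  The colon ideal
of the monomial of g by the earlier ones is generated by variables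
([power_monomial_colon]): x_L if A > 0 (lowering a y-exponent of g gives an
earlier monomial, whose x_L-exponent is larger by one), x_R if B > 0, and each
leaf that comes after some leaf of the same side that occurs in g (exchange the
two).  So the number of variables is the sum, over the two sides, of the number
of leaves from the first one that occurs in g to the end of its side.

It remains to sum 'C(q, i) over all g.  Splitting off the g in which the first
leaf of a side occurs, for one side and then for the other, shows that the mixed
second difference of this sum in r and l is one product of two binomial
coefficients; the closed form of the theorem has the same second difference and
the same boundary values ([span_sum_closed]). *)

Set Implicit Arguments.
Unset Strict Implicit.
Unset Printing Implicit Defensive.

Import Order.TTheory GRing.Theory.
Local Open Scope ring_scope.

(** * Comparison of projective resolutions *)

(** Chain maps and homotopies are built one degree at a time, each map depending
on the previous one; [P] is the condition that lets the construction go on. *)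
Lemma sequence_by_steps (T : nat -> Type) (P : forall i, T i -> Prop)
    (Q : forall i, T i -> T i.+1 -> Prop) (t0 : T 0%N) :
  P 0%N t0 -> (forall i t, P i t -> exists t', P i.+1 t' /\ Q i t t') ->
  exists f : forall i, T i,
    [/\ f 0%N = t0, forall i, P i (f i) & forall i, Q i (f i) (f i.+1)].
Proof.
move=> P0 step.
pose next i (t : {t : T i | P i t}) : {t' : T i.+1 | P i.+1 t' /\ Q i (sval t) t'} :=
  constructive_indefinite_description _ (step i (sval t) (proj2_sig t)).
pose fix F i : {t : T i | P i t} := match i with
  | 0%N => exist _ t0 P0
  | j.+1 => exist _ (sval (next j (F j))) (proj1 (proj2_sig (next j (F j)))) end.
exists (fun i => sval (F i)); split=> // i; first exact: proj2_sig (F i).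
exact: proj2 (proj2_sig (next i (F i))).
Qed.

Section Image.
Variables (R : comNzRingType) (N N' : lmodType R) (g : {linear N -> N'}).

(** Membership in an image is undecidable in general, while submodules as types are
cut out by boolean predicates; hence the classical test. *)
Definition image_pred : {pred N'} := fun y =>
  if excluded_middle_informative (exists x, g x = y) then true else false.

Lemma image_predP y : reflect (exists x, g x = y) (y \in image_pred).
Proof.
rewrite unfold_in /image_pred.
by case: excluded_middle_informative => h; constructor.
Qed.

Fact image_submod_closed : GRing.submod_closed image_pred.
Proof.
split=> [|a _ _ /image_predP[x <-] /image_predP[y <-]]; apply/image_predP.
  by exists 0; rewrite linear0.
by exists (a *: x + y); rewrite linearP.
Qed.

HB.instance Definition _ :=
  GRing.isSubmodClosed.Build R N' image_pred image_submod_closed.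

Record image_module :=
  ImageModule { image_val :> N'; _ : image_val \in image_pred }.

HB.instance Definition _ := [isSub for image_val].
HB.instance Definition _ := [Choice of image_module by <:].
HB.instance Definition _ := [SubChoice_isSubLmodule of image_module by <:].

End Image.

Section Comparison.
Variable R : comNzRingType.

(** A projective module lifts along maps that are only onto the relevant image:
corestrict [d] and [f] to the image of [d], a module in its own right. *)
Lemma projective_lift (M Z Y : lmodType R) (d : {linear Z -> Y})
    (f : {linear M -> Y}) : projective M -> (forall x, exists z, d z = f x) ->
  exists h : {linear M -> Z}, forall x, d (h x) = f x.
Proof.
move=> projM fd.
have f_im x : f x \in image_pred d by apply/image_predP.
have d_im x : d x \in image_pred d by apply/image_predP; exists x.
pose f' x : image_module d := ImageModule (f_im x).
pose d' x : image_module d := ImageModule (d_im x).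
have f'_lin : linear f'.
  by move=> a x y; apply: val_inj; rewrite /= linearP.
have d'_lin : linear d'.
  by move=> a x y; apply: val_inj; rewrite /= linearP.
pose f'l := GRing.isLinear.Build _ _ _ _ f' f'_lin.
pose d'l := GRing.isLinear.Build _ _ _ _ d' d'_lin.
pose F : {linear M -> image_module d} := HB.pack f' f'l.
pose D : {linear Z -> image_module d} := HB.pack d' d'l.
have [y|h hE] := projM _ _ D F.
  have /image_predP[x xy] := valP y.
  by exists x; apply: val_inj.
exists h => x; exact: (congr1 val (hE x)).
Qed.

Section Augmented.
Variable M : nat -> lmodType R.
(** Placing the ring itself in degree 0 makes the augmentation one more
differential, so the inductions below have no separate base case for it. *)
Definition aug_mod i : lmodType R := if i is j.+1 then M j else R^o.

Variables (d : forall i, {linear M i.+1 -> M i}) (eps : {linear M 0%N -> R^o}).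
Definition aug_map i : {linear aug_mod i.+1 -> aug_mod i} :=
  if i is j.+1 then d j else eps.
End Augmented.

Definition proj_res (I : R -> Prop) (M : nat -> lmodType R)
    (d : forall i, {linear M i.+1 -> M i}) (eps : {linear M 0%N -> R^o}) :=
  [/\ forall i, projective (M i), forall f : R, I f <-> exists x, eps x = f &
      forall i, exact_at (aug_map d eps i.+1) (aug_map d eps i)].

Section TwoResolutions.
Variables (I : R -> Prop).
Variables (M : nat -> lmodType R) (d : forall i, {linear M i.+1 -> M i})
  (eps : {linear M 0%N -> R^o}).
Variables (N : nat -> lmodType R) (e : forall i, {linear N i.+1 -> N i})
  (eta : {linear N 0%N -> R^o}).
Let D := aug_map d eps.
Let E := aug_map e eta.

(** Start from the identity of the ring, which carries the image of [eps] into that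
of [eta] as both are [I]; exactness of the target provides each next lift. *)
Lemma comparison_map : proj_res I d eps -> proj_res I e eta ->
  exists phi : forall i, {linear aug_mod M i -> aug_mod N i},
    (forall x, phi 0%N x = x) /\
    (forall i x, E i (phi i.+1 x) = phi i (D i x)).
Proof.
move=> [projM imM exM] [_ imN exN].
have := @sequence_by_steps (fun i => {linear aug_mod M i -> aug_mod N i})
  (fun i phi => forall x, exists y, E i y = phi (D i x))
  (fun i phi phi' => forall x, E i (phi' x) = phi (D i x)) (idfun : {linear R^o -> R^o}).
case=> [x|i phi hphi|phi [phi0 _ phiE]].
- by apply/imN/imM; exists x.
- have [h hE] := projective_lift (f := phi \o D i) (projM i) hphi.
  exists h; split=> // x; apply/exN; rewrite -/(E i) hE /=.
  suff -> : D i (D i.+1 x) = 0 by rewrite linear0.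
  by apply/exM; exists x.
- by exists phi; split=> // x; rewrite phi0.
Qed.

End TwoResolutions.

Section Homotopy.
Variables (I : R -> Prop).
Variables (M : nat -> lmodType R) (d : forall i, {linear M i.+1 -> M i})
  (eps : {linear M 0%N -> R^o}).
Let D := aug_map d eps.

(** The usual homotopy, with the first component zero because [chi] vanishes on the
ring: the part of chi_(i+1) not accounted for by [h i] takes values in cycles. *)
Lemma null_homotopy (chi : forall i, {linear aug_mod M i -> aug_mod M i}) :
  proj_res I d eps -> (forall x, chi 0%N x = 0) ->
  (forall i x, D i (chi i.+1 x) = chi i (D i x)) ->
  exists h : forall i, {linear aug_mod M i -> aug_mod M i.+1},
    (forall x, h 0%N x = 0) /\
    (forall i x, chi i.+1 x = D i.+1 (h i.+1 x) + h i (D i x)).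
Proof.
move=> [projM imM exM] chi0 chiE.
have := @sequence_by_steps (fun i => {linear aug_mod M i -> aug_mod M i.+1})
  (fun i h => forall x, D i (h (D i x)) = chi i (D i x))
  (fun i h h' => forall x, chi i.+1 x = D i.+1 (h' x) + h (D i x)) (\0 : {linear R^o -> M 0%N}).
case=> [x|i h hP|h [h0 _ hE]].
- by rewrite chi0 linear0.
- have [|h' h'E] := @projective_lift _ _ _ (D i.+1) (chi i.+1 \- (h \o D i)) (projM i).
    by move=> x; apply/exM; rewrite linearB /= -/(D i) chiE hP subrr.
  have DD x : D i (D i.+1 x) = 0 by apply/exM; exists x.
  exists h'; split=> x; last by rewrite h'E /= subrK.
  by rewrite h'E /= DD linear0 subr0.
- by exists h; split=> // x; rewrite h0.
Qed.

End Homotopy.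
End Comparison.

(** * Invariants read off a minimal graded resolution *)

(** Choose preimages of the images of the standard basis. *)
Lemma projective_rV (R : comNzRingType) n : projective 'rV[R]_n.
Proof.
move=> N N' g f g_surj.
have [b bE] : exists b : 'I_n -> N, forall i, g (b i) = f (delta_mx 0 i).
  exists (fun i => sval (constructive_indefinite_description _ (g_surj (f (delta_mx 0 i))))).
  by move=> i; case: constructive_indefinite_description.
pose h (v : 'rV[R]_n) := \sum_i v 0 i *: b i.
have h_lin : linear h.
  move=> a u v; rewrite /h scaler_sumr -big_split; apply: eq_bigr => i _ /=.
  by rewrite !mxE scalerDl scalerA.
pose hl := GRing.isLinear.Build _ _ _ _ h h_lin.
exists (HB.pack h hl : {linear _ -> _}) => v /=.
rewrite [in RHS](row_sum_delta v) !linear_sum; apply: eq_bigr => i _.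
by rewrite !linearZ /= bE.
Qed.

Section MinimalResolution.
Variables (K : fieldType) (n : nat).
Local Notation P := {mpoly K[n]}.

Lemma irrelevant_ideal_meval0 (p : P) : irrelevant_ideal p -> p.@[fun=> 0] = 0.
Proof.
case=> s [sP ->]; rewrite raddf_sum big_seq big1 //= => cg /sP[i ->].
by rewrite mevalM mevalXU mulr0.
Qed.

Local Notation ev := (map_mx (meval (fun=> 0 : K))).

Section OfComplex.
Variables (I : P -> Prop) (F : graded_free_complex K n).

Definition gc_module i : lmodType P := 'rV[P]_(gc_rank F i).
Definition gc_map i : {linear gc_module i.+1 -> gc_module i} := mulmxr (gc_diff F i).

Definition gc_augmentation (v : gc_module 0) : P^o := (v *m gc_aug F) 0 0.
Fact gc_augmentation_linear : linear gc_augmentation.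
Proof. by move=> a u v; rewrite /gc_augmentation mulmxDl -scalemxAl !mxE. Qed.
HB.instance Definition _ :=
  GRing.isLinear.Build _ _ _ _ gc_augmentation gc_augmentation_linear.

Lemma graded_resolution_proj_res :
  is_resolution I F -> proj_res I gc_map gc_augmentation.
Proof.
case=> imF ex0 exF; split=> // [i|[|i]]; first exact: projective_rV.
- move=> v; rewrite -(ex0 v) /= /gc_augmentation; split=> [h|->]; last by rewrite mxE.
  by apply/rowP => j; rewrite ord1 h mxE.
- exact: exF.
Qed.

(** id - psi phi is null homotopic, and both terms D h and h D of the homotopy vanish
at the origin: the entries of D do by minimality, and a linear map between free
modules is a matrix, so it preserves vanishing at the origin. *)
Lemma minimal_retract_mod_irrelevant (N : nat -> lmodType P)
    (e : forall i, {linear N i.+1 -> N i}) (eta : {linear N 0%N -> P^o}) i :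
  is_resolution I F -> is_minimal F -> proj_res I e eta ->
  exists (phi : {linear gc_module i -> N i}) (psi : {linear N i -> gc_module i}),
    forall v, ev (psi (phi v)) = ev v.
Proof.
move=> /graded_resolution_proj_res resF minF resN.
have [phi [phi0 phiE]] := comparison_map resF resN.
have [psi [psi0 psiE]] := comparison_map resN resF.
pose chi i : {linear aug_mod gc_module i -> aug_mod gc_module i} :=
  idfun \- (psi i \o phi i).
have [|j x|h [h0 hE]] := @null_homotopy _ I _ gc_map gc_augmentation chi resF.
- by move=> x; rewrite /= psi0 phi0 subrr.
- by rewrite linearB /= psiE phiE.
exists (phi i.+1), (psi i.+1) => v; apply/eqP; rewrite eq_sym -subr_eq0 -map_mxB.
(* [chi] is the chain map id - psi phi; the index is shifted by the augmentation. *)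
have -> : v - psi i.+1 (phi i.+1 v) = chi i.+1 v by [].
have ev_d j (w : gc_module j.+1) : ev (gc_map j w) = 0.
  rewrite /= map_mxM /= (_ : ev (gc_diff F j) = 0) ?mulmx0 //.
  by apply/matrixP => a b; rewrite !mxE irrelevant_ideal_meval0.
rewrite hE map_mxD ev_d add0r; case: i v => [|i] v.
  by rewrite h0 map_mx0.
have := ev_d i v; rewrite /=; set w := v *m _ => evw.
by rewrite -(mul_rV_lin1 (h i.+1)) map_mxM /= evw mul0mx.
Qed.
End OfComplex.

(** At the origin the two comparison maps become matrices over the field whose
product is the identity of size rank F_i; that identity factors through a space of
dimension rank G_i. *)
Lemma minimal_rank_leq (I : P -> Prop) F G i :
  is_resolution I F -> is_minimal F -> is_resolution I G ->
  (gc_rank F i <= gc_rank G i)%N.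
Proof.
move=> resF minF /graded_resolution_proj_res resG.
have [phi [psi h]] := minimal_retract_mod_irrelevant i resF minF resG.
suff : ev (lin1_mx phi) *m ev (lin1_mx psi) = 1%:M by move/mulmx1_min.
rewrite -map_mxM /=; apply/row_matrixP => a.
rewrite -map_row -[row a _]mul1mx; have := h (delta_mx 0 a).
rewrite -(mul_rV_lin1 psi) -(mul_rV_lin1 phi) -mulmxA mul1mx -rowE /= => ->.
by apply/rowP => b; rewrite !mxE rmorph_nat eqxx /= eq_sym.
Qed.

Lemma minimal_rank_betti (I : P -> Prop) F b :
  is_resolution I F -> is_minimal F -> (forall i, gc_rank F i = b i) -> is_betti I b.
Proof.
move=> resF minF Fb; split; first by exists F.
move=> G resG minG i; rewrite -Fb; apply/eqP; rewrite eqn_leq.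
by rewrite (minimal_rank_leq _ resG minG resF) (minimal_rank_leq _ resF minF resG).
Qed.

(** If a projective resolution N stopped before p, then N_p = 0 and the identity of the
nonzero space F_p at the origin would factor through 0. *)
Lemma minimal_resolution_pd (I : P -> Prop) F p :
  is_resolution I F -> is_minimal F -> (0 < gc_rank F p)%N ->
  (forall i, (p < i)%N -> gc_rank F i = 0%N) -> is_pd I p.
Proof.
move=> resF minF Fp Fi; have [projF imF exF] := graded_resolution_proj_res resF.
split.
  exists (gc_module F), (gc_map F), (gc_augmentation (F := F)); split=> //.
  - move=> i /Fi; rewrite /gc_module => ri x; apply/rowP => j.
    by exfalso; move: j; rewrite ri; case.
  - exact: exF 0%N.
  - by move=> i; exact: exF i.+1.
move=> m [N [e [eta [projN N0 imN ex0 exN]]]].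
have resN : proj_res I e eta by split=> // -[].
have [phi [psi h]] := minimal_retract_mod_irrelevant p resF minF resN.
rewrite leqNgt; apply/negP => /N0 Np0.
have := h (delta_mx 0 (Ordinal Fp)); rewrite (Np0 (phi _)) linear0 map_mx0.
move/rowP/(_ (Ordinal Fp)); rewrite !mxE !eqxx rmorph1 => /eqP.
by rewrite eq_sym oner_eq0.
Qed.

End MinimalResolution.

(** * Linear resolutions and mapping cones *)

Section LinearResolution.
Variables (K : fieldType) (n : nat).
Local Notation P := {mpoly K[n]}.

Definition homog_mx d p q (A : 'M[P]_(p, q)) := forall i j, A i j \is d.-homog.

Lemma homog_mulmx d e p q r (A : 'M[P]_(p, q)) (B : 'M[P]_(q, r)) :
  homog_mx d A -> homog_mx e B -> homog_mx (d + e) (A *m B).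
Proof.
by move=> hA hB i j; rewrite mxE; apply: rpred_sum => k _; apply: dhomogM.
Qed.

Lemma homog_mxN d p q (A : 'M[P]_(p, q)) : homog_mx d A -> homog_mx d (- A).
Proof. by move=> hA i j; rewrite mxE rpredN. Qed.

(** Compare the homogeneous components of p q with those of p, multiplied by q. *)
Lemma pihomog_mulr (d e : nat) (p q : P) : q \is e.-homog ->
  pihomog mdeg (d + e) (p * q) = pihomog mdeg d p * q.
Proof.
move=> hq; rewrite [in LHS](pihomog_partitionE (leqnn (msize p))).
rewrite mulr_suml linear_sum /=.
have piM (i : nat) : pihomog mdeg (d + e) (pihomog mdeg i p * q) =
    if i == d then pihomog mdeg d p * q else 0.
  have hi : pihomog mdeg i p * q \is (i + e).-homog.
    by apply: dhomogM => //; apply: pihomogP.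
  case: eqP => [id|/eqP id]; first by rewrite -id pihomog_dE.
  by apply: (pihomog_ne0 _ hi); rewrite eqn_add2r.
under eq_bigr => i _ do rewrite piM.
case: (ltnP d (msize p)) => hd.
  rewrite (bigD1 (Ordinal hd)) //= eqxx big1 ?addr0 // => i.
  by rewrite -val_eqE /= => /negPf ->.
rewrite big1 => [|i _]; last first.
  by rewrite ifN //; apply: contraTN (ltn_ord i) => /eqP ->; rewrite -leqNgt.
suff -> : pihomog mdeg d p = 0 by rewrite mul0r.
rewrite pihomogE big_seq_cond big1 // => m /andP[/msize_mdeg_lt hm /eqP hd'].
by move: (leq_trans hm hd); rewrite hd' ltnn.
Qed.

(** A linear system with homogeneous data keeps being solved when the unknowns are
replaced by their components of the right degree; this makes lifts homogeneous. *)
Lemma homog_solution (d e p q r : nat) (D : 'M[P]_(q, r)) (B : 'M[P]_(p, r)) :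
  homog_mx e D -> homog_mx (d + e) B -> (exists X : 'M_(p, q), X *m D = B) ->
  exists2 X : 'M_(p, q), homog_mx d X & X *m D = B.
Proof.
move=> hD hB [X XD]; exists (map_mx (pihomog mdeg d) X).
  by move=> i j; rewrite mxE; apply: pihomogP.
apply/matrixP => i j; rewrite -[RHS](pihomog_dE (hB i j)) -XD !mxE linear_sum /=.
by apply: eq_bigr => k _; rewrite mxE pihomog_mulr.
Qed.

Lemma mulmx_rows_solve (p q r : nat) (D : 'M[P]_(q, r)) (B : 'M[P]_(p, r)) :
  (forall i, exists v : 'rV_q, v *m D = row i B) -> exists X : 'M_(p, q), X *m D = B.
Proof.
move=> hB.
exists (\matrix_i sval (constructive_indefinite_description _ (hB i))).
apply/row_matrixP => i; rewrite row_mul rowK.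
by case: constructive_indefinite_description.
Qed.

Lemma exact_mx_solve (p q r s : nat) (D' : 'M[P]_(q, r)) (D : 'M[P]_(r, s))
    (B : 'M[P]_(p, r)) :
  exact_at (fun v : 'rV_q => v *m D') (fun v => v *m D) ->
  B *m D = 0 -> exists X : 'M_(p, q), X *m D' = B.
Proof.
move=> exD BD; apply: mulmx_rows_solve => i; apply/exD.
by rewrite -row_mul BD row0.
Qed.

Lemma exact_mx0 (q r s : nat) (D' : 'M[P]_(q, r)) (D : 'M[P]_(r, s)) :
  exact_at (fun v : 'rV_q => v *m D') (fun v => v *m D) -> D' *m D = 0.
Proof.
move=> exD; apply/row_matrixP => i; rewrite row_mul row0; apply/exD.
by exists (delta_mx 0 i); rewrite -rowE.
Qed.

(** Ranks of the augmented complex: the polynomial ring is in degree 0. *)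
Definition aug_rank (b : nat -> nat) i := if i is j.+1 then b j else 1%N.

(** [lin_res J d b]: a linear free resolution of [J], generated in degree [d], with
ranks [b].  The augmented complex resolves P / J, whence the homogeneity condition:
degree [d] for the generators and 1 for all later differentials. *)
Definition lin_res (J : P -> Prop) (d : nat) (b : nat -> nat) : Prop :=
  exists D : forall i, 'M[P]_(b i, aug_rank b i),
    [/\ forall f, J f <-> exists v : 'rV_(b 0%N), v *m D 0%N = f%:M,
        forall i, exact_at (fun v : 'rV_(b i.+1) => v *m D i.+1)
                           (fun v : 'rV_(b i) => v *m D i) &
        forall i, homog_mx (if i is 0%N then d else 1%N) (D i)].

Lemma lin_res_ext (J J' : P -> Prop) d b b' :
  (forall f, J f <-> J' f) -> b =1 b' -> lin_res J d b -> lin_res J' d b'.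
Proof.
move=> JJ' /functional_extensionality <- [D [h1 h2 h3]].
by exists D; split=> // f; rewrite -JJ'.
Qed.

Lemma lin_res_zero d : lin_res (fun f => f = 0) d (fun=> 0%N).
Proof.
exists (fun i => 0); split=> [f|i v|i []] //; last first.
  by split=> _; [exists 0; apply/rowP => -[] | rewrite mulmx0].
split=> [->|[v /matrixP/(_ 0 0)]]; first by exists 0; rewrite mul0mx raddf0.
by rewrite mulmx0 !mxE mulr1n.
Qed.

Section Cone.
Variables (J C : P -> Prop) (d : nat) (u : P) (b c : nat -> nat).
Hypotheses (hu : u \is d.-homog) (CJ : forall f, C f <-> J (f * u)).
Variable D : forall i, 'M[P]_(b i, aug_rank b i).
Hypothesis imD : forall f, J f <-> exists v : 'rV_(b 0%N), v *m D 0%N = f%:M.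
Hypothesis exD : forall i, exact_at (fun v : 'rV_(b i.+1) => v *m D i.+1)
                                    (fun v : 'rV_(b i) => v *m D i).
Hypothesis hD : forall i, homog_mx (if i is 0%N then d else 1%N) (D i).
Variable E : forall i, 'M[P]_(c i, aug_rank c i).
Hypothesis imE : forall f, C f <-> exists v : 'rV_(c 0%N), v *m E 0%N = f%:M.
Hypothesis exE : forall i, exact_at (fun v : 'rV_(c i.+1) => v *m E i.+1)
                                    (fun v : 'rV_(c i) => v *m E i).
Hypothesis hE : forall i, homog_mx 1 (E i).

(** Multiplication by [u] maps P / C to P / J, and [phi] lifts it to the resolutions,
up to a sign that saves signs in the cone.  Each [phi i] has the degree of [D i]
because the differentials of both complexes are linear, so [phi] enters the cone
without destroying linearity. *)
Lemma multiplication_chain_map :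
  exists phi : forall i, 'M[P]_(aug_rank c i, aug_rank b i),
    [/\ phi 0%N = u%:M, forall i, homog_mx (if i is 0%N then d else 1%N) (phi i) &
        forall i, phi i.+1 *m D i = - (E i *m phi i)].
Proof.
have := @sequence_by_steps (fun i => 'M[P]_(aug_rank c i, aug_rank b i))
  (fun i phi => homog_mx (if i is 0%N then d else 1%N) phi /\
     exists X, X *m D i = - (E i *m phi))
  (fun i phi phi' => phi' *m D i = - (E i *m phi)) u%:M.
case=> [|i phi [hphi hX]|phi [phi0 hphi phiE]].
- split; first by move=> i j; rewrite !ord1 mxE mulr1n.
  apply: mulmx_rows_solve => i; set w := row i _.
  have -> : w = (- (E 0%N i 0 * u))%:M.
    by apply/rowP => j; rewrite ord1 !mxE big_ord1 !mxE !mulr1n.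
  apply/imD; rewrite -mulNr; apply/CJ/imE; exists (- delta_mx 0 i).
  by rewrite mulNmx -rowE; apply/rowP => j; rewrite ord1 !mxE mulr1n.
- have [|phi' hphi' phi'E] := homog_solution (d := 1) (@hD i) _ hX.
    by apply: homog_mxN; apply: homog_mulmx.
  exists phi'; split=> //; split=> //.
  apply: (exact_mx_solve (@exD i)).
  by rewrite mulNmx -mulmxA phi'E mulmxN mulmxA (exact_mx0 (@exE i)) mul0mx !oppr0.
- by exists phi; split=> // i; case: (hphi i).
Qed.

Definition cone_rank i := (b i + aug_rank c i)%N.

(** The mapping cone of [phi]; the ring that resolves P / C in degree 0 becomes, one
degree higher, the free summand of the new generator [u]. *)
Definition cone_diff (phi : forall i, 'M[P]_(aug_rank c i, aug_rank b i)) i :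
    'M[P]_(cone_rank i, aug_rank cone_rank i) :=
  match i with
  | 0%N => col_mx (D 0%N) (phi 0%N)
  | j.+1 => block_mx (D j.+1) 0 (phi j.+1) (E j)
  end.

(** A cycle of the cone is a pair (f, g) with g a cycle of E, or an element of
C = J : u in lowest degree; subtracting the boundary of a preimage of g leaves a
cycle of D. *)
Lemma cone_lin_res :
  lin_res (fun f => exists g p, J g /\ f = g + p * u) d cone_rank.
Proof.
have [phi [phi0 hphi phiE]] := multiplication_chain_map.
exists (cone_diff phi); split.
- move=> f; split=> [[g [p [/imD[v vE] ->]]]|[w wE]].
    exists (row_mx v p%:M); rewrite /= mul_row_col vE phi0 -scalar_mxM.
    by rewrite -raddfD.
  exists ((lsubmx w *m D 0%N) 0 0), (rsubmx w 0 0); split.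
    by apply/imD; exists (lsubmx w); rewrite -mx11_scalar.
  have : lsubmx w *m D 0%N + rsubmx w *m u%:M = f%:M.
    by rewrite -phi0 -mul_row_col hsubmxK.
  by move/matrixP/(_ 0 0); rewrite mul_mx_scalar !mxE !mulr1n mulrC => <-.
- move=> i; have main (f : 'rV_(b i)) (g : 'rV_(aug_rank c i)) :
      f *m D i + g *m phi i = 0 -> (exists h, h *m E i = g) ->
      exists x, x *m cone_diff phi i.+1 = row_mx f g.
    (* Correct (f, g) by the boundary of (0, h), where h is a preimage of g. *)
    move=> fg [h hg]; have : (f - h *m phi i.+1) *m D i = 0.
      by rewrite mulmxBl -mulmxA phiE mulmxN mulmxA hg opprK.
    case/exD => t tE; exists (row_mx t h).
    by rewrite /= mul_row_block tE hg mulmx0 add0r subrK.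
  move=> y; split=> [|[x <-]]; last first.
    rewrite -[x]hsubmxK /= mul_row_block mulmx0 add0r.
    case: i main x {y} => [|i] main x /=.
      rewrite mul_row_col mulmxDl -!mulmxA phiE mulmxN subrK.
      by rewrite (exact_mx0 (@exD 0%N)) mulmx0.
    rewrite mul_row_block mulmxDl -!mulmxA phiE mulmxN subrK.
    rewrite mulmx0 add0r (exact_mx0 (@exD _)) (exact_mx0 (@exE _)) !mulmx0.
    by rewrite row_mx0.
  rewrite -[y]hsubmxK; move: (lsubmx y) (rsubmx y) => f g.
  case: i main f g {y} => [|i] main f g /=.
    rewrite mul_row_col => fg; apply: main => //.
    rewrite [g]mx11_scalar; apply/imE/CJ/imD; exists (- f).
    rewrite mulNmx (addr0_eq fg) phi0 mul_mx_scalar.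
    by apply/rowP => j; rewrite ord1 !mxE mulr1n mulrC.
  rewrite mul_row_block mulmx0 add0r => fg.
  have : row_mx (f *m D i.+1 + g *m phi i.+1) (g *m E i) = row_mx 0 0.
    by rewrite fg row_mx0.
  by case/eq_row_mx => fg0 /exE; apply: main.
- case=> [|i] a k /=.
    rewrite mxE; case: splitP => j _; first exact: (@hD 0%N).
    exact: (hphi 0%N).
  rewrite !mxE; case: splitP => j _; rewrite mxE; case: splitP => j' _;
    rewrite ?mxE ?rpred0 //; [exact: (@hD i.+1)|exact: (hphi i.+1)|exact: (@hE i)].
Qed.
End Cone.

Lemma lin_res_add_generator (J C : P -> Prop) d u b c :
  u \is d.-homog -> (forall f, C f <-> J (f * u)) ->
  lin_res J d b -> lin_res C 1 c ->
  lin_res (fun f => exists g p, J g /\ f = g + p * u) d (fun i => b i + aug_rank c i)%N.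
Proof.
move=> hu CJ [D [imD exD hD]] [E [imE exE hE]].
apply: (cone_lin_res hu CJ imD exD hD imE exE) => -[|i]; [exact: (hE 0%N)|exact: (hE i.+1)].
Qed.

Lemma linear_form_irrelevant (p : P) : p \is 1.-homog -> irrelevant_ideal p.
Proof.
move=> /dhomogP hp; exists [seq ((p@_m)%:MP, 'X_[m]) | m <- msupp p]; split.
  move=> cg /mapP[m /hp /eqP hm ->] /=.
  by case/mdeg1P: hm => i /eqP ->; exists i.
by rewrite big_map {1}[p]mpolyE; apply: eq_bigr => m _; rewrite mul_mpolyC.
Qed.

(** Linearity puts the free module in degree i of the resolution in internal degree
d + i, and linear forms lie in the irrelevant ideal. *)
Lemma lin_res_graded (J : P -> Prop) d b : lin_res J d b ->
  exists F, [/\ is_resolution J F, is_minimal F & forall i, gc_rank F i = b i].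
Proof.
case=> D [imD exD hD].
have hdiff i (a : 'I_(b i.+1)) (k : 'I_(b i)) :
    homog_of_degree ((d + i.+1)%:Z - (d + i)%:Z) (D i.+1 a k).
  have -> : (d + i.+1)%:Z - (d + i)%:Z = 1%:Z by lia.
  exact: (hD i.+1).
have haug (a : 'I_(b 0%N)) : homog_of_degree (d + 0)%:Z (D 0%N a 0).
  rewrite addn0; exact: (hD 0%N).
exists (GradedFreeComplex (gc_deg := fun i _ => (d + i)%:Z) hdiff haug); split=> //.
- split=> [f| |i] /=; [rewrite imD|exact: (exD 0%N)|exact: (exD i.+1)].
  split=> -[v vE]; exists v; first by rewrite vE mxE mulr1n.
  by rewrite -vE -mx11_scalar.
- by move=> i a k; apply: linear_form_irrelevant; apply: (hD i.+1).
Qed.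

End LinearResolution.

(** * Monomial ideals with linear quotients *)

Section MonomialIdeals.
Variables (K : fieldType) (n : nat).
Local Notation P := {mpoly K[n]}.
Implicit Types (A : 'X_{1..n} -> Prop) (u m : 'X_{1..n}).

(** For an upward closed [A] this is the monomial ideal of the monomials in [A].
Describing ideals by supports turns sums and colons into statements about
exponents. *)
Definition mon_span A : P -> Prop := fun f => forall m, m \in msupp f -> A m.

Lemma mon_span_ext A A' f : (forall m, A m <-> A' m) -> mon_span A f <-> mon_span A' f.
Proof. by move=> AA'; split=> h m /h /AA'. Qed.

Lemma mon_span_sum A (T : eqType) (r : seq T) (F : T -> P) :
  (forall t, t \in r -> mon_span A (F t)) -> mon_span A (\sum_(t <- r) F t).
Proof.
move=> h m /msupp_sum_le /flattenP[s /mapP[t + ->]].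
by rewrite mem_filter /= => /h; apply.
Qed.

Lemma mon_spanX A m : A m -> mon_span A 'X_[m].
Proof. by move=> Am m' /mem_msuppXP <-. Qed.

Lemma mon_spanZX A c m : A m -> mon_span A (c *: 'X_[m]).
Proof. by move=> Am m' /msuppZ_le /mem_msuppXP <-. Qed.

Lemma mon_span_colon A u f :
  mon_span (fun m => A (u + m)%MM) f <-> mon_span A (f * 'X_[u]).
Proof.
split=> h m; first by rewrite (perm_mem (msuppMX _ _)) => /mapP[m' /h + ->].
by move=> mf; apply: h; rewrite (perm_mem (msuppMX _ _)) map_f.
Qed.

(** Sort the monomials of [f] by divisibility by [u]. *)
Lemma mon_span_add A u f :
  mon_span (fun m => A m \/ (u <= m)%MM) f <->
  exists g p, mon_span A g /\ f = g + p * 'X_[u].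
Proof.
split=> [h|[g [p [gA ->]]] m /msuppD_le]; last first.
  rewrite mem_cat => /orP[/gA|]; first by left.
  by rewrite (perm_mem (msuppMX _ _)) => /mapP[m' _ ->]; right; apply: lem_addr.
exists (\sum_(m <- msupp f | ~~ (u <= m)%MM) f@_m *: 'X_[m]).
exists (\sum_(m <- msupp f | (u <= m)%MM) f@_m *: 'X_[m - u]); split.
  rewrite -big_filter; apply: mon_span_sum => m; rewrite mem_filter.
  by case/andP=> um /h[Am|]; [apply: mon_spanZX | rewrite (negPf um)].
rewrite mulr_suml addrC [LHS]mpolyE (bigID (fun m => (u <= m)%MM)) /=.
congr (_ + _); apply: eq_bigr => m um.
by rewrite -scalerAl -mpolyXD submK.
Qed.

Lemma lin_res_add_monomial A d u b c : mdeg u = d ->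
  lin_res (mon_span A) d b -> lin_res (mon_span (fun m => A (u + m)%MM)) 1 c ->
  lin_res (mon_span (fun m => A m \/ (u <= m)%MM)) d (fun i => b i + aug_rank c i)%N.
Proof.
move=> du resA resC.
have hu : 'X_[u] \is [in K[n], d.-homog] by rewrite dhomogX; apply/eqP.
apply: lin_res_ext (lin_res_add_generator hu (@mon_span_colon A u) resA resC) => //.
by move=> f; rewrite mon_span_add.
Qed.

Lemma lin_res_empty d : lin_res (mon_span (fun=> False)) d (fun=> 0%N).
Proof.
apply: lin_res_ext (@lin_res_zero K n d) => // f; split=> [-> m|h].
  by rewrite mcoeff_msupp mcoeff0 eqxx.
by apply: msuppnil0; move: h; rewrite /mon_span; case: msupp => // m s /(_ m (mem_head m s)).
Qed.

(** The ranks are those of the Koszul complex: each new variable is a nonzerodivisor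
modulo the previous ones, so the colon ideal is the ideal already resolved, and
Pascal's rule adds up the ranks. *)
Lemma koszul_lin_res (s : seq 'I_n) : uniq s ->
  lin_res (mon_span (fun m => has (fun x => 0 < m x)%N s)) 1 (fun i => 'C(size s, i.+1)).
Proof.
elim: s => [_|x s IHs /= /andP[xs us]].
  by apply: lin_res_ext (lin_res_empty 1) => //= f; apply: mon_span_ext.
have res := IHs us.
have resC : lin_res (mon_span (fun m => has (fun y => 0 < (U_(x) + m)%MM y)%N s)) 1
    (fun i => 'C(size s, i.+1)).
  apply: lin_res_ext res => // f; apply: mon_span_ext => m.
  rewrite (@eq_in_has _ _ (fun y => 0 < (U_(x) + m)%MM y)%N) // => y ys.
  by rewrite mnmDE mnm1E; case: eqP xs ys => // -> /negPf ->.
apply: lin_res_ext (lin_res_add_monomial (mdeg1 x) res resC) => [f|i].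
  apply: mon_span_ext => m /=; rewrite lep1mP -lt0n orbC.
  by split; [case=> -> //; rewrite orbT | case/orP; [left|right]].
by case: i => [|i] /=; rewrite binS ?bin0.
Qed.

(** One mapping cone for each monomial of the list, the colon ideal being resolved by
a Koszul complex. *)
Lemma linear_quotients (T : eqType) (mono : T -> 'X_{1..n}) (vars : T -> seq 'I_n)
    (d : nat) (s : seq T) :
  (forall t, t \in s -> mdeg (mono t) = d /\ uniq (vars t)) ->
  (forall s1 t s2, s = s1 ++ t :: s2 -> forall m,
     has (fun v => mono v <= mono t + m)%MM s1 = has (fun x => 0 < m x)%N (vars t)) ->
  lin_res (mon_span (fun m => has (fun t => mono t <= m)%MM s)) d
          (fun i => \sum_(t <- s) 'C(size (vars t), i))%N.
Proof.
elim/last_ind: s => [|s t IHs] hs colon.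
  apply: lin_res_ext (lin_res_empty d) => [f|i]; first exact: mon_span_ext.
  by rewrite big_nil.
have [dt ut] : mdeg (mono t) = d /\ uniq (vars t) by apply: hs; rewrite mem_rcons mem_head.
have resS : lin_res (mon_span (fun m => has (fun t => mono t <= m)%MM s)) d
    (fun i => \sum_(t <- s) 'C(size (vars t), i))%N.
  apply: IHs => [v vs|s1 v s2 sE]; first by apply: hs; rewrite mem_rcons inE vs orbT.
  by apply: (colon s1 v (rcons s2 t)); rewrite sE rcons_cat.
have resC : lin_res (mon_span (fun m => has (fun v => mono v <= mono t + m)%MM s)) 1
    (fun i => 'C(size (vars t), i.+1)).
  apply: lin_res_ext (koszul_lin_res ut) => // f; apply: mon_span_ext => m.
  by rewrite (colon s t [::]) // cats1.
apply: lin_res_ext (lin_res_add_monomial dt resS resC) => [f|i].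
  apply: mon_span_ext => m; rewrite has_rcons.
  by split; [case=> -> //; rewrite orbT | case/orP; [right|left]].
by rewrite big_rcons /=; case: i => [|i] //=; rewrite bin0.
Qed.

Lemma ideal_gen_mon_span (S : P -> Prop) A :
  (forall m m', A m -> (m <= m')%MM -> A m') ->
  (forall g, S g -> mon_span A g) ->
  (forall m, A m -> exists c g, S g /\ 'X_[m] = c * g) ->
  forall f, ideal_gen S f <-> mon_span A f.
Proof.
move=> Aup SA AS f; split=> [[s [sS ->]]|fA].
  apply: mon_span_sum => cg /sS/SA gA m /msuppM_le /allpairsP[[m1 m2] /= [_ /gA Am ->]].
  exact: Aup Am (lem_addl _ _).
have gen m : exists cg : P * P, A m -> S cg.2 /\ 'X_[m] = cg.1 * cg.2.
  have [/AS[c [g [Sg e]]]|nA] := excluded_middle_informative (A m).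
    by exists (c, g).
  by exists (0, 0).
pose G m := sval (constructive_indefinite_description _ (gen m)).
have GP m : A m -> S (G m).2 /\ 'X_[m] = (G m).1 * (G m).2.
  by rewrite /G; case: constructive_indefinite_description.
exists [seq (f@_m *: (G m).1, (G m).2) | m <- msupp f]; split.
  by move=> cg /mapP[m /fA/GP[Sg _] ->].
rewrite big_map {1}[f]mpolyE big_seq [RHS]big_seq; apply: eq_bigr => m /fA/GP[_ e].
by rewrite -scalerAl -e.
Qed.

Lemma ideal_mul_mon_span (I J : P -> Prop) A B :
  (forall f, I f <-> mon_span A f) -> (forall f, J f <-> mon_span B f) ->
  forall f, ideal_mul I J f <->
    mon_span (fun m => exists a b, [/\ A a, B b & (a + b <= m)%MM]) f.
Proof.
move=> IA JB; apply: ideal_gen_mon_span => [m m' [a [b [Aa Bb ab]]] mm'|g|m].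
- by exists a, b; split=> //; apply: lepm_trans mm'.
- case=> f [h [/IA fA /JB hB ->]] m /msuppM_le /allpairsP[[m1 m2] /= [/fA A1 /hB B2 ->]].
  by exists m1, m2; split=> //; apply: lepm_refl.
- case=> a [b [Aa Bb ab]]; exists 'X_[m - (a + b)], 'X_[a + b].
  split; last by rewrite -mpolyXD submK.
  exists 'X_[a], 'X_[b]; split; last by rewrite mpolyXD.
  + by apply: (IA _).2; apply: mon_spanX.
  + by apply: (JB _).2; apply: mon_spanX.
Qed.

Lemma edge_ideal_mon_span (G : simple_graph 'I_n) f :
  edge_ideal K G f <->
  mon_span (fun m => exists u v : 'I_n, G u v /\ (U_(u) + U_(v) <= m)%MM) f.
Proof.
apply: ideal_gen_mon_span => {f} [m m' [u [v [Guv uv]]] mm'|_ [u [v [Guv ->]]]|m].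
- by exists u, v; split=> //; apply: lepm_trans mm'.
- by rewrite -mpolyXD; apply: mon_spanX; exists u, v; split=> //; apply: lepm_refl.
- case=> u [v [Guv uv]]; exists 'X_[m - (U_(u) + U_(v))], ('X_u * 'X_v).
  by split; [exists u, v | rewrite -!mpolyXD submK].
Qed.

Fixpoint edge_product (G : simple_graph 'I_n) k m : Prop :=
  if k is k'.+1 then exists (u v : 'I_n) m',
    [/\ G u v, edge_product G k' m' & (U_(u) + U_(v) + m' <= m)%MM]
  else True.

Lemma edge_ideal_pow_mon_span (G : simple_graph 'I_n) k f :
  ideal_pow (edge_ideal K G) k f <-> mon_span (edge_product G k) f.
Proof.
elim: k f => [|k IHk] f; first by [].
rewrite /= (ideal_mul_mon_span (@edge_ideal_mon_span G) IHk).
apply: mon_span_ext => m; split.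
  case=> a [b [[u [v [Guv ua]]] bk ab]]; exists u, v, b; split=> //.
  apply: lepm_trans ab; apply/mnm_lepP => i; rewrite [in leqRHS]mnmDE mnmDE leq_add2r.
  exact/mnm_lepP.
case=> u [v [m' [Guv m'k le_m]]]; exists (U_(u) + U_(v))%MM, m'; split=> //.
by exists u, v; split=> //; apply: lepm_refl.
Qed.

End MonomialIdeals.

(** * Sums of binomial coefficients over bounded exponent sequences *)

Section Counting.
Local Open Scope nat_scope.

(** Sequences of length [n] with sum at most [k], enumerated by Pascal's rule: the
first entry is 0, or it can be lowered by 1. *)
Fixpoint bounded_seqs (n : nat) : nat -> seq (seq nat) :=
  if n is n'.+1 then
    fix aux k := [seq 0 :: s | s <- bounded_seqs n' k] ++
                 (if k is k'.+1 then [seq incr_nth s 0 | s <- aux k'] else [::])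
  else fun=> [:: [::]].

(** The number of variables that one side of the graph contributes to a colon ideal, if
[s] lists the exponents of its leaves. *)
Fixpoint support_span (s : seq nat) : nat :=
  if s is x :: s' then if x == 0 then support_span s' else (size s').+1 else 0.

Arguments bounded_seqs : simpl never.

Lemma bounded_seqsS0 n :
  bounded_seqs n.+1 0 = [seq 0 :: s | s <- bounded_seqs n 0].
Proof. by rewrite /bounded_seqs -/bounded_seqs cats0. Qed.

Lemma bounded_seqsSS n k :
  bounded_seqs n.+1 k.+1 = [seq 0 :: s | s <- bounded_seqs n k.+1] ++
                           [seq incr_nth s 0 | s <- bounded_seqs n.+1 k].
Proof. by []. Qed.

Lemma mem_bounded_seqs n k s :
  (s \in bounded_seqs n k) = (size s == n) && (sumn s <= k).
Proof.
elim: n k s => [|n IHn] k s; first by case: s => [|x s].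
elim: k s => [|k IHk] s.
  rewrite bounded_seqsS0; apply/mapP/idP.
    by case=> t; rewrite IHn => /andP[/eqP <- h] ->; rewrite /= eqxx.
  case: s => [|[|x] s] //= /andP[/eqP[hs] h]; last by rewrite addSn in h.
  by exists s; rewrite // IHn hs eqxx.
rewrite bounded_seqsSS mem_cat; apply/orP/idP.
  case=> /mapP[t]; first by rewrite IHn => /andP[/eqP <- h] ->; rewrite /= eqxx.
  by rewrite IHk => /andP[]; case: t => [|x t] //= hs h ->; rewrite /= hs.
case: s => [|[|x] s] //= /andP[/eqP[hs] h].
  by left; apply/mapP; exists s; rewrite // IHn hs eqxx.
by right; apply/mapP; exists (x :: s); rewrite // IHk /= hs eqxx.
Qed.

Lemma bounded_seqs_uniq n k : uniq (bounded_seqs n k).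
Proof.
elim: n k => [|n IHn] // ; elim=> [|k IHk].
  by rewrite bounded_seqsS0 map_inj_uniq // => s t [].
rewrite bounded_seqsSS cat_uniq map_inj_uniq ?IHn; last by move=> s t [].
rewrite map_inj_in_uniq ?IHk ?andbT /=.
  apply/hasPn => _ /mapP[s + ->]; rewrite mem_bounded_seqs.
  by case: s => [|x s] // _; apply/mapP; case.
move=> s t; rewrite !mem_bounded_seqs.
by case: s t => [|x s] [|y t] // _ _ /= [-> ->].
Qed.

Section Sums.
Variable h : nat -> nat -> nat.

(** The generic sum over bounded sequences of a function of the unused budget and of
the support span.  Sequences with a nonzero first entry all have full span, which
is what makes the recursion [seq_sumSS] explicit. *)
Definition seq_sum n k :=
  \sum_(s <- bounded_seqs n k) h (k - sumn s) (support_span s).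

Lemma seq_sum0 k : seq_sum 0 k = h k 0.
Proof. by rewrite /seq_sum big_seq1 subn0. Qed.

Lemma seq_sumS0 n : seq_sum n.+1 0 = seq_sum n 0.
Proof. by rewrite /seq_sum bounded_seqsS0 big_map. Qed.

Lemma seq_sumSS n k :
  seq_sum n.+1 k.+1 = seq_sum n k.+1 +
    \sum_(s <- bounded_seqs n.+1 k) h (k - sumn s) n.+1.
Proof.
rewrite /seq_sum bounded_seqsSS big_cat !big_map /=; congr addn.
apply: eq_big_seq => s; rewrite mem_bounded_seqs.
by case: s => [|x s] //= /andP[/eqP[->] _].
Qed.
End Sums.

Lemma sum_bin_bounded_seqs n k a b : a <= b ->
  \sum_(s <- bounded_seqs n k) 'C(a + (k - sumn s), b) = 'C(n + a + k, n + b).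
Proof.
move=> hab; pose h j (m : nat) := 'C(a + j, b).
rewrite -/(seq_sum h n k); elim: n k => [|n IHn] k; first by rewrite seq_sum0.
elim: k => [|k IHk].
  by rewrite seq_sumS0 IHn !addn0 addSn addSn binS [X in _ = X + _]bin_small
    ?add0n // !ltnS leq_add2l.
rewrite seq_sumSS -/(seq_sum h n.+1 k) IHk IHn.
by rewrite !addnS !addSn [in RHS]binS addnC.
Qed.

Lemma size_bounded_seqs n k : size (bounded_seqs n k) = 'C(n + k, n).
Proof.
have := sum_bin_bounded_seqs n k (leqnn 0); rewrite !addn0 => <-.
rewrite -sum1_size; apply: eq_bigr => s _; by rewrite bin0.
Qed.

(** Pairs of sequences whose total is at most [k]: the exponents of the two kinds of
leaves in a generator of the k-th power. *)
Definition span_sum (i r l k : nat) : nat :=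
  \sum_(s <- bounded_seqs r k) \sum_(t <- bounded_seqs l (k - sumn s))
     'C(support_span s + support_span t, i).

(** For p <= n both sides count the ways to split n + k objects into parts of sizes p, n - p
and k. *)
Lemma bin_mul_symm n k p :
  'C(n + k, n) * 'C(n, p) = 'C(n + k, k + p) * 'C(k + p, p).
Proof.
case: (ltnP n p) => [hp|/subnKC <-].
  rewrite ['C(n, p)]bin_small // muln0 ['C(_, k + p)]bin_small ?mul0n //; lia.
move: (n - p) => q; apply/eqP.
have f0 : 0 < p`! * q`! * k`! by rewrite !muln_gt0 !fact_gt0.
rewrite -(eqn_pmul2r f0); apply/eqP.
have h1 := bin_fact (leq_addr k (p + q)).
have h2 := bin_fact (leq_addr q p).
have h3 : k + p <= p + q + k by lia.
have {h3} := bin_fact h3.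
have := bin_fact (leq_addl k p).
rewrite addKn in h1; rewrite addKn in h2.
have -> : p + q + k - (k + p) = q by lia.
rewrite addnK; move: h1 h2; set a := 'C(_, _); set b := 'C(_, _).
set c := 'C(_, _); set d := 'C(_, _) => h1 h2 h3 h4.
transitivity ((p + q + k)`!); first by rewrite -h1 -h2; ring.
by rewrite -h4 -h3; ring.
Qed.

Definition shifted_span_sum i l k a :=
  \sum_(t <- bounded_seqs l k) 'C(a + support_span t, i).

Lemma shifted_span_sum0 i k a : shifted_span_sum i 0 k a = 'C(a, i).
Proof. by rewrite /shifted_span_sum big_seq1 addn0. Qed.

Lemma shifted_span_sumS i l k a :
  shifted_span_sum i l.+1 k a =
  shifted_span_sum i l k a + 'C(a + l.+1, i) * 'C(l + k, l.+1).
Proof.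
pose h (_ m : nat) := 'C(a + m, i).
rewrite /shifted_span_sum -![\sum_(t <- _) _]/(seq_sum h _ _).
case: k => [|k]; first by rewrite seq_sumS0 [X in _ * X]bin_small ?muln0 ?addn0.
rewrite seq_sumSS; congr addn.
by rewrite big_const_seq count_predT iter_addn_0 size_bounded_seqs addSnnS.
Qed.

Lemma span_sumSS i r l k :
  span_sum i r.+1 l k.+1 = span_sum i r l k.+1 +
  \sum_(s <- bounded_seqs r.+1 k) shifted_span_sum i l (k - sumn s) r.+1.
Proof. exact: (seq_sumSS (fun j m => shifted_span_sum i l j m)). Qed.

Lemma span_sum0n i l k : span_sum i 0 l k = shifted_span_sum i l k 0.
Proof. by rewrite /span_sum big_seq1 subn0. Qed.

Lemma shifted_span_sum_closed l k j :
  shifted_span_sum j.+1 l k.+1 0 = 'C(k + j.+1, j.+1) * 'C(l + k.+1, k + j.+2).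
Proof.
elim: l => [|l IHl].
  rewrite shifted_span_sum0 bin0n [X in _ * X]bin_small ?muln0 //; lia.
rewrite shifted_span_sumS IHl add0n.
have := bin_mul_symm l.+1 k j.+1; rewrite [l.+1 + k]addSnnS => e.
rewrite [X in _ + X]mulnC e addSn [in RHS](_ : k + j.+2 = (k + j.+1).+1) ?addnS //.
by rewrite ['C(_.+2, _)]binS mulnDr; congr addn; rewrite mulnC.
Qed.

(** The increment of [span_sum] in [r]; its own increment in [l] is a single product
of two binomial coefficients, which [bin_mul_symm] brings into the required form. *)
Lemma span_increment_closed r l k j :
  \sum_(s <- bounded_seqs r.+1 k) shifted_span_sum j.+1 l (k - sumn s) r.+1 =
  'C(k + j, j.+1) * 'C(r + l + k.+1, k + j.+1) + 'C(k + j, j) * 'C(r + k.+1, k + j.+1).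
Proof.
elim: l => [|l IHl].
  under eq_bigr => s _ do rewrite shifted_span_sum0.
  rewrite big_const_seq count_predT iter_addn_0 size_bounded_seqs addn0.
  (* For l = 0 the two terms on the right merge by Pascal's rule. *)
  rewrite -mulnDl [in RHS]addnC.
  have := bin_mul_symm r.+1 k j.+1; rewrite mulnC => ->.
  rewrite mulnC addSnnS; congr muln.
  by rewrite addnS binS addnC.
under eq_bigr => s _ do rewrite shifted_span_sumS.
rewrite big_split /= {}IHl -big_distrr /= sum_bin_bounded_seqs //.
rewrite addnAC; congr addn.
have -> : r + l.+1 + k.+1 = (r + l + k.+1).+1 by lia.
rewrite [k + j.+1]addnS ['C(_.+1, (k + j).+1) in RHS]binS mulnDr; congr addn.
case: k => [|k].
  rewrite !add0n mulnC ['C(_, r.+1 + l.+1)]bin_small; last by lia.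
  by rewrite ['C(j, j.+1)]bin_small.
have := bin_mul_symm (r.+1 + l.+1) k j.+1; rewrite mulnC.
have -> : r.+1 + l.+1 + k = r + l + k.+2 by lia.
have -> : k.+1 + j = k + j.+1 by lia.
have -> : r.+1 + l + k.+1 = r + l + k.+2 by lia.
by move=> ->; rewrite mulnC.
Qed.

Lemma span_sum_closed r l k j :
  span_sum j.+1 r l k.+1 = 'C(k + j, j.+1) * 'C(r + l + k.+1, k + j.+2)
    + 'C(k + j, j) * ('C(r + k.+1, k + j.+2) + 'C(l + k.+1, k + j.+2)).
Proof.
elim: r => [|r IHr].
  rewrite span_sum0n shifted_span_sum_closed !add0n.
  rewrite ['C(k.+1, _)]bin_small ?add0n; last by lia.
  by rewrite -mulnDl; congr muln; rewrite addnS binS.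
rewrite span_sumSS IHr span_increment_closed.
rewrite !addSn [k + j.+2]addnS.
rewrite ['C((r + l + k.+1).+1, _)]binS ['C((r + k.+1).+1, _)]binS.
ring.
Qed.

Lemma span_sum_index0 r l k : span_sum 0 r l k = 'C(r + l + k, k).
Proof.
rewrite -bin_sub ?leq_addl // addnK -(sum_bin_bounded_seqs r k (leqnn l)).
apply: eq_bigr => s _.
under eq_bigr => t _ do rewrite bin0.
by rewrite sum1_size size_bounded_seqs.
Qed.

(** Position i of [s] is in the span when [s] has a nonzero entry before i or at i.
The left side counts entries strictly before i, which misses exactly the first
nonzero position; the last term restores it. *)
Lemma support_spanE s :
  \sum_(i < size s) has (leq 1) (take i s) + (0 < sumn s) = support_span s.
Proof.
elim: s => [|x s IHs] /=; first by rewrite big_ord0.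
rewrite big_ord_recl /= add0n; case: x => [|x] /=; first by rewrite add0n.
by rewrite sum1_card card_ord addn1.
Qed.

End Counting.

(** * Powers of the edge ideal of the whisker graph *)

Section WhiskerPowers.
Variables r l : nat.
Local Notation V := 'I_(2 + (r + l)).
Local Notation G := (whisker r l).
Implicit Types (g h : 'X_{1..r + l}) (m : 'X_{1..2 + (r + l)}).
Local Open Scope nat_scope.

Definition side (i : 'I_(r + l)) : bool := i < r.
(** The leaves with [side] true hang on x_R, those with [side] false on x_L.  The far
hub of a side is the one its leaves do not hang on: a leaf edge of that side costs
one factor of the far hub compared with the edge x_R x_L. *)
Definition far_hub (b : bool) : V := if b then wh_xL r l else wh_xR r l.
Definition leaf (i : 'I_(r + l)) : V := rshift 2 i.

Definition side_deg b g := \sum_(i | side i == b) g i.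

(** The product of [k] edges whose leaf exponents are [g]: every edge contains both
hubs, except that leaf edges omit the far hub of their side. *)
Definition power_monomial k g : 'X_{1..2 + (r + l)} :=
  [multinom match split v with
            | inl h => k - side_deg (h == ord_max) g
            | inr i => g i end | v < 2 + (r + l)].

Lemma vertexP v : (exists b, v = far_hub b) \/ (exists i, v = leaf i).
Proof.
rewrite -(splitK v); case: (split v) => [j|i]; last by right; exists i.
left; exists (j == ord_max); rewrite /far_hub /=.
apply: val_inj; case: eqP => [->|] //=; case: j => [[|[|j]] hj] //.
by case; apply: val_inj.
Qed.

Lemma far_hub_eq b b' : (far_hub b == far_hub b') = (b == b').
Proof. by case: b b' => -[]; rewrite -val_eqE. Qed.

Lemma far_hub_leaf b i : (far_hub b == leaf i) = false.
Proof. by case: b; rewrite -val_eqE. Qed.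

Lemma leaf_eq i j : (leaf i == leaf j) = (i == j).
Proof. exact: (inj_eq (@rshift_inj _ _)). Qed.

Lemma power_monomial_hub k g b : power_monomial k g (far_hub b) = k - side_deg b g.
Proof.
by rewrite mnmE /far_hub; case: b; rewrite /wh_xL /wh_xR (unsplitK (inl _)).
Qed.

Lemma power_monomial_leaf k g i : power_monomial k g (leaf i) = g i.
Proof. by rewrite mnmE (unsplitK (inr _)). Qed.

Lemma power_monomial_leP k g m :
  (forall b : bool, k - side_deg b g <= m (far_hub b)) /\ (forall i, g i <= m (leaf i)) <->
  (power_monomial k g <= m)%MM.
Proof.
split=> [[hubs leaves]|/mnm_lepP le_m].
  apply/mnm_lepP => v; case: (vertexP v) => [[b ->]|[i ->]].
    by rewrite power_monomial_hub.
  by rewrite power_monomial_leaf.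
split=> [b|i]; first by rewrite -(power_monomial_hub k).
by rewrite -(power_monomial_leaf k).
Qed.

Lemma side_degD b g h : side_deg b (g + h) = side_deg b g + side_deg b h.
Proof.
by rewrite -big_split; apply: eq_bigr => i _ /=; rewrite mnmDE.
Qed.

Lemma side_degU b i : side_deg b U_(i) = (side i == b).
Proof.
rewrite /side_deg; case: eqP => [ib|ib].
  rewrite (bigD1 i) /= ?ib // mnm1E eqxx big1 // => j /andP[_ ji].
  by rewrite mnm1E eq_sym (negPf ji).
by apply: big1 => j /eqP jb; rewrite mnm1E; case: eqP => // ij; case: ib; rewrite ij.
Qed.

Lemma mdeg_sides g : mdeg g = side_deg true g + side_deg false g.
Proof.
rewrite mdegE (bigID side) /side_deg /=; congr addn; apply: eq_bigl => i.
  by case: side.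
by case: side.
Qed.

Lemma side_deg_leq b g : side_deg b g <= mdeg g.
Proof. by rewrite mdeg_sides; case: b; lia. Qed.

Lemma mnm_pos_sub g i : 0 < g i -> exists h, g = (h + U_(i))%MM.
Proof. by move=> gi; exists (g - U_(i))%MM; rewrite submK // lep1mP -lt0n. Qed.

Lemma side_deg_pos b g : 0 < side_deg b g -> exists2 i, side i = b & 0 < g i.
Proof.
rewrite lt0n sum_nat_eq0 negb_forall => /existsP[i].
by rewrite negb_imply -lt0n => /andP[/eqP ib gi]; exists i.
Qed.

Lemma mdeg_power_monomial k g : mdeg g <= k -> mdeg (power_monomial k g) = k + k.
Proof.
move=> gk; rewrite mdegE big_split_ord /= [X in X + _]big_ord_recl big_ord1.
under eq_bigr => i _ do rewrite power_monomial_leaf.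
rewrite -mdegE mdeg_sides.
have := power_monomial_hub k g false; have := power_monomial_hub k g true.
have -> : lshift (r + l) (lift ord0 ord0) = far_hub true.
  by apply: val_inj.
rewrite /= /far_hub /wh_xR => -> ->.
have := side_deg_leq true g; have := side_deg_leq false g.
move: gk; rewrite mdeg_sides; lia.
Qed.

Lemma edge_cases u v : G u v ->
  (exists b, u = far_hub b /\ v = far_hub (~~ b)) \/
  (exists i, (u = leaf i /\ v = far_hub (~~ side i)) \/
             (v = leaf i /\ u = far_hub (~~ side i))).
Proof.
have arc x y : wh_arc x y -> (exists b, x = far_hub b /\ y = far_hub (~~ b)) \/
    (exists i, y = leaf i /\ x = far_hub (~~ side i)).
  case/or3P => [/andP[/eqP -> /eqP ->]|/andP[/eqP -> /existsP[i /eqP ->]]|].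
  - by left; exists false.
  - by right; exists (lshift l i); rewrite /side /= ltn_ord.
  - case/andP=> /eqP -> /existsP[i /eqP ->].
    by right; exists (rshift r i); rewrite /side /= ltnNge leq_addr.
case/orP => /arc [[b [-> ->]]|[i [-> ->]]]; [left|right|left|right].
- by exists b.
- by exists i; right.
- by exists (~~ b); rewrite negbK.
- by exists i; left.
Qed.

Lemma edge_hubs : G (far_hub false) (far_hub true).
Proof. by apply/orP; left; apply/or3P; apply: Or31; rewrite !eqxx. Qed.

Lemma edge_leaf i : G (leaf i) (far_hub (~~ side i)).
Proof.
apply/orP; right; rewrite -(splitK i); case: (split i) => j; apply/or3P.
  apply: Or32; rewrite /side /= ltn_ord eqxx; by apply/existsP; exists j.
by apply: Or33; rewrite /side /= ltnNge leq_addr eqxx; apply/existsP; exists j.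
Qed.

(** Multiplying by the edge of the hubs raises [k] and keeps [g]; multiplying by a leaf
edge raises [k] and the exponent of the leaf.  Conversely a [g] of degree at most
[k] leaves room for a hub edge, and a [g] of degree k + 1 has a leaf to remove. *)
Lemma edge_product_whisker k m :
  edge_product G k m <-> exists g, mdeg g <= k /\ (power_monomial k g <= m)%MM.
Proof.
elim: k m => [|k IHk] m.
  split=> // _; exists 0%MM; rewrite mdeg0; split=> //.
  by apply/power_monomial_leP; split=> [b|i]; rewrite ?mnm0E.
have hub_step g m' : (power_monomial k g <= m')%MM ->
    (power_monomial k.+1 g <= U_(far_hub false) + U_(far_hub true) + m')%MM.
  move=> /power_monomial_leP[hubs leaves]; apply/power_monomial_leP; split=> [b|i].
    have := hubs b; rewrite !mnmDE !mnm1E !far_hub_eq; case: b => /=; lia.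
  by rewrite !mnmDE (leq_trans (leaves i)) // leq_addl.
have leaf_step g m' i : (power_monomial k g <= m')%MM ->
    (power_monomial k.+1 (g + U_(i)) <= U_(leaf i) + U_(far_hub (~~ side i)) + m')%MM.
  move=> /power_monomial_leP[hubs leaves]; apply/power_monomial_leP; split=> [b|j].
    have := hubs b; rewrite !mnmDE !mnm1E side_degD side_degU far_hub_eq.
    by case: b; case: (side i) => /=; lia.
  have := leaves j; rewrite !mnmDE !mnm1E leaf_eq; lia.
split=> [[u [v [m' [uv /IHk[g [gk gm]] le_m]]]]|[g [gk gm]]].
  have leafP i : (U_(leaf i) + U_(far_hub (~~ side i)) + m' <= m)%MM ->
      exists g', mdeg g' <= k.+1 /\ (power_monomial k.+1 g' <= m)%MM.
    move=> le_m'; exists (g + U_(i))%MM; rewrite mdegD mdeg1 addn1; split=> //.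
    exact: lepm_trans (leaf_step _ _ i gm) le_m'.
  case: (edge_cases uv) => [[b [ub vb]]|[i [[ui vi]|[vi ui]]]]; last 2 first.
  - by apply: (leafP i); rewrite -ui -vi.
  - by apply: (leafP i); rewrite -ui -vi [(U_(v) + _)%MM]addmC.
  exists g; split; first exact: leqW.
  apply: lepm_trans (hub_step _ _ gm) _; move: le_m; rewrite ub vb.
  by case: b {ub vb} => //=; rewrite [(U_(far_hub true) + _)%MM]addmC.
case: (leqP (mdeg g) k) => [gk'|k_lt_g].
  exists (far_hub false), (far_hub true), (power_monomial k g).
  split; [exact: edge_hubs|by apply/IHk; exists g; split=> //; exact: lepm_refl|].
  move/power_monomial_leP: gm => [hubs leaves]; apply/mnm_lepP => v.
  case: (vertexP v) => [[b ->]|[i ->]].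
    have := hubs b; have := side_deg_leq b g.
    rewrite !mnmDE !mnm1E !far_hub_eq power_monomial_hub; case: b => /=; lia.
  have := leaves i; rewrite !mnmDE !mnm1E !far_hub_leaf power_monomial_leaf; lia.
have [i /mnm_pos_sub[h gE]] : exists i, 0 < g i.
  have : 0 < side_deg true g \/ 0 < side_deg false g by move: (mdeg_sides g); lia.
  by case=> /side_deg_pos[i _ gi]; exists i.
exists (leaf i), (far_hub (~~ side i)), (power_monomial k h).
move: gk; rewrite gE mdegD mdeg1 addn1 => hk; split; first exact: edge_leaf.
  by apply/IHk; exists h; split=> //; exact: lepm_refl.
move/power_monomial_leP: gm => [hubs leaves]; apply/mnm_lepP => v.
case: (vertexP v) => [[b ->]|[j ->]].
  have := hubs b; have := side_deg_leq b h; rewrite gE side_degD side_degU.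
  rewrite !mnmDE !mnm1E far_hub_eq power_monomial_hub [leaf _ == _]eq_sym far_hub_leaf.
  by case: b; case: (side i) => /=; lia.
have := leaves j; rewrite gE !mnmDE !mnm1E leaf_eq far_hub_leaf power_monomial_leaf; lia.
Qed.

(** The generators of the colon ideal of the monomial of [g] by the earlier ones:
the far hub of a side reflects the removal of a leaf, and a leaf of the second kind
replaces an earlier leaf of its side. *)
Definition colon_vars g : seq V :=
  [seq far_hub b | b <- [:: true; false] & 0 < side_deg b g] ++
  [seq leaf i | i : 'I_(r + l) <- enum 'I_(r + l) &
                [exists p : 'I_(r + l), [&& p < i, side p == side i & 0 < g p]]].

Lemma colon_vars_uniq g : uniq (colon_vars g).
Proof.
rewrite cat_uniq; apply/and3P; split.
- rewrite map_inj_uniq ?filter_uniq // => b b' /eqP.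
  by rewrite far_hub_eq => /eqP.
- apply/hasPn => _ /mapP[i _ ->]; apply/mapP => -[b _ /eqP].
  by rewrite eq_sym far_hub_leaf.
- rewrite map_inj_uniq; first by apply: filter_uniq; apply: enum_uniq.
  by move=> i j /eqP; rewrite leaf_eq => /eqP.
Qed.

Lemma has_colon_vars g m : reflect
  ((exists b : bool, 0 < side_deg b g /\ 0 < m (far_hub b)) \/
   (exists i p : 'I_(r + l), [/\ p < i, side p = side i, 0 < g p & 0 < m (leaf i)]))
  (has (fun x => 0 < m x) (colon_vars g)).
Proof.
rewrite has_cat !has_map; apply: (iffP orP); case.
- by case/hasP=> b; rewrite mem_filter => /andP[gb _] mb; left; exists b.
- case/hasP=> i; rewrite mem_filter => /andP[/existsP[p /and3P[pi /eqP sp gp]] _] mi.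
  by right; exists i, p.
- case=> b [gb mb]; left; apply/hasP; exists b => //.
  by rewrite mem_filter gb; case: b {gb mb}.
- case=> i [p [pi sp gp mi]]; right; apply/hasP; exists i => //.
  rewrite mem_filter mem_enum andbT; apply/existsP; exists p.
  by rewrite pi sp gp eqxx.
Qed.

Lemma mnm_pos_exchange g (p i : 'I_(r + l)) : p < i -> 0 < g p ->
  exists2 h, (h < g)%O & exists e, g = (e + U_(p))%MM /\ h = (e + U_(i))%MM.
Proof.
move=> pi /mnm_pos_sub[e ->]; exists (e + U_(i))%MM; last by exists e.
apply/ltmcP; first by rewrite !mdegD !mdeg1.
exists p => [j jp|]; rewrite !mnmDE !mnm1E -!val_eqE /=; lia.
Qed.

(** Suppose that h precedes g.  If h has smaller degree on some side, the far hub of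
that side divides the quotient of the two monomials.  Otherwise the degrees agree
on both sides; at the first difference p, h is smaller than g, so h must exceed g at
a later leaf of the side of p.  Conversely, remove or exchange a leaf. *)
Lemma power_monomial_colon k g m : mdeg g <= k ->
  (exists2 h, (h < g)%O & (power_monomial k h <= power_monomial k g + m)%MM) <->
  has (fun x => 0 < m x) (colon_vars g).
Proof.
move=> gk; split=> [[h hg /power_monomial_leP[hubs leaves]]|/has_colon_vars].
  apply/has_colon_vars.
  have hub_le (b : bool) : k - side_deg b h <= k - side_deg b g + m (far_hub b).
    by have := hubs b; rewrite mnmDE power_monomial_hub.
  have leaf_le i : h i <= g i + m (leaf i).
    by have := leaves i; rewrite mnmDE power_monomial_leaf.
  have hub_case (b : bool) : side_deg b h < side_deg b g ->
      exists b : bool, 0 < side_deg b g /\ 0 < m (far_hub b).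
    by move=> lt; exists b; have := hub_le b; have := side_deg_leq b g; lia.
  have [/hub_case|ge_t] := ltnP (side_deg true h) (side_deg true g); first by left.
  have [/hub_case|ge_f] := ltnP (side_deg false h) (side_deg false g); first by left.
  have le_deg : mdeg h <= mdeg g by apply: lemc_mdeg; apply: ltW.
  have eq_deg (b : bool) : side_deg b h = side_deg b g.
    by move: le_deg; rewrite !mdeg_sides; case: b; lia.
  have [|p p_first p_lt] := ltmcP _ hg.
    by rewrite !mdeg_sides !eq_deg.
  right; suff [i [sp pi hi]] : exists i : 'I_(r + l), [/\ side p = side i, p < i & g i < h i].
    by exists i, p; split=> //; [lia | have := leaf_le i; lia].
  (* Without a leaf of the side of p where h exceeds g, the inequality at p would make
     the degree of h on this side smaller than that of g. *)
  have [i /andP[/eqP ip hi]|none] := pickP (fun i => (side i == side p) && (g i < h i)).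
    exists i; split=> //; rewrite ltnNge; apply/negP; rewrite leq_eqVlt => /orP[|/p_first].
      by move/eqP/val_inj => e; move: hi; rewrite e; lia.
    by move=> e; move: hi; rewrite e ltnn.
  have := eq_deg (side p); rewrite /side_deg (bigD1 p) //= [in RHS](bigD1 p) //=.
  have : \sum_(i | (side i == side p) && (i != p)) h i <=
         \sum_(i | (side i == side p) && (i != p)) g i.
    apply: leq_sum => i /andP[ip _]; rewrite leqNgt.
    by have := none i; rewrite ip /= => ->.
  by move=> le_rest eq_sum; have := leq_add p_lt le_rest; rewrite addSn eq_sum ltnn.
case=> [[b [gb mb]]|[i [p [pi sp gp mi]]]].
  have [p pb /mnm_pos_sub[h gE]] := side_deg_pos gb.
  exists h; first by apply: lt_mdeg_ltmc; rewrite gE mdegD mdeg1 addn1.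
  apply/power_monomial_leP; split=> [b'|i].
    have := side_deg_leq b' g; rewrite mnmDE power_monomial_hub gE side_degD side_degU pb.
    by case: eqP => [<-|_]; lia.
  by rewrite mnmDE power_monomial_leaf gE mnmDE; lia.
have [h hg [e [gE hE]]] := mnm_pos_exchange pi gp.
exists h => //; apply/power_monomial_leP; split=> [b|j].
  by rewrite mnmDE power_monomial_hub gE hE !side_degD !side_degU sp; lia.
rewrite mnmDE power_monomial_leaf gE hE !mnmDE !mnm1E.
by case: eqP => [<-|_]; lia.
Qed.

Definition mnm_of_seqs (st : seq nat * seq nat) : 'X_{1..r + l} :=
  [multinom nth 0 (st.1 ++ st.2) i | i < r + l].

Definition seqs_of_mnm g : seq nat * seq nat :=
  ([seq g (lshift l i) | i <- enum 'I_r], [seq g (rshift r j) | j <- enum 'I_l]).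

Lemma seqs_of_mnmK : cancel seqs_of_mnm mnm_of_seqs.
Proof.
move=> g; apply/mnmP => i; rewrite mnmE nth_cat size_map size_enum_ord.
rewrite -(splitK i); case: (split i) => j /=.
  by rewrite ltn_ord (nth_map j) ?size_enum_ord // nth_ord_enum.
by rewrite ltnNge leq_addr addKn (nth_map j) ?size_enum_ord // nth_ord_enum.
Qed.

Section OfSeqs.
Variables s t : seq nat.
Hypotheses (ss : size s = r) (st : size t = l).
Let g := mnm_of_seqs (s, t).

Lemma mnm_of_seqs_lshift i : g (lshift l i) = nth 0 s i.
Proof. by rewrite mnmE nth_cat /= ss ltn_ord. Qed.

Lemma mnm_of_seqs_rshift j : g (rshift r j) = nth 0 t j.
Proof. by rewrite mnmE nth_cat /= ss ltnNge leq_addr addKn. Qed.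

Lemma side_deg_mnm_of_seqs b : side_deg b g = sumn (if b then s else t).
Proof.
rewrite /side_deg big_mkcond big_split_ord /=.
under eq_bigr => i _ do rewrite mnm_of_seqs_lshift /side /= ltn_ord.
under [X in _ + X]eq_bigr => i _ do
  rewrite mnm_of_seqs_rshift /side /= ltnNge leq_addr /=.
case: b => /=.
  by rewrite [X in _ + X]big1 // addn0 sumnE (big_nth 0) big_mkord ss.
by rewrite big1 // sumnE (big_nth 0) big_mkord st.
Qed.

Lemma mnm_of_seqsK : seqs_of_mnm g = (s, t).
Proof.
congr pair; apply: (@eq_from_nth _ 0); try by rewrite size_map size_enum_ord.
  move=> i; rewrite size_map size_enum_ord => hi.
  rewrite (nth_map (Ordinal hi)) ?size_enum_ord // mnm_of_seqs_lshift.
  by rewrite nth_enum_ord.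
move=> i; rewrite size_map size_enum_ord => hi.
rewrite (nth_map (Ordinal hi)) ?size_enum_ord // mnm_of_seqs_rshift.
by rewrite nth_enum_ord.
Qed.

Lemma exchange_lshift i :
  [exists p : 'I_(r + l), [&& p < lshift l i, side p == side (lshift l i) & 0 < g p]] =
  has (leq 1) (take i s).
Proof.
have si : i <= size s by rewrite ss ltnW.
rewrite {2}/side /= ltn_ord.
apply/existsP/(has_nthP 0) => [[p /and3P[pi /eqP sp gp]]|[q]].
  exists (p : nat); rewrite ?size_takel // nth_take //.
  have pr : p < r := sp.
  have pE : p = lshift l (Ordinal pr) by apply: val_inj.
  by move: gp; rewrite {1}pE mnm_of_seqs_lshift.
rewrite size_takel // => qi; rewrite nth_take // => sq.
have qr := ltn_trans qi (ltn_ord i).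
exists (lshift l (Ordinal qr)); rewrite mnm_of_seqs_lshift /= qi sq andbT.
by rewrite /side /= qr.
Qed.

Lemma exchange_rshift j :
  [exists p : 'I_(r + l), [&& p < rshift r j, side p == side (rshift r j) & 0 < g p]] =
  has (leq 1) (take j t).
Proof.
have sj : j <= size t by rewrite st ltnW.
rewrite {2}/side /= [r + j < r]ltnNge leq_addr /=.
apply/existsP/(has_nthP 0) => [[p /and3P[pj /eqP sp gp]]|[q]].
  have [q pE] : exists q, p = rshift r q.
    move: sp; rewrite -(splitK p); case: (split p) => q; last by exists q.
    by rewrite /side /= ltn_ord.
  move: pj gp; rewrite pE mnm_of_seqs_rshift /= ltn_add2l => qj tq.
  by exists (q : nat); rewrite ?size_takel // nth_take.
rewrite size_takel // => qj; rewrite nth_take // => tq.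
exists (rshift r (Ordinal (ltn_trans qj (ltn_ord j)))).
by rewrite mnm_of_seqs_rshift /= ltn_add2l qj tq /side /= ltnNge leq_addr.
Qed.

(** A side that occurs in [g] contributes its far hub and all leaves after the first
one that occurs: as many variables as leaves from that one on. *)
Lemma size_colon_vars : size (colon_vars g) = support_span s + support_span t.
Proof.
rewrite size_cat !size_map !size_filter /= addn0 !side_deg_mnm_of_seqs.
rewrite -sum1_count big_enum_cond big_mkcond big_split_ord /=.
under eq_bigr => i _ do rewrite exchange_lshift.
under [X in _ + (_ + X)]eq_bigr => j _ do rewrite exchange_rshift.
by rewrite -(support_spanE s) -(support_spanE t) ss st [RHS]addnACA addnC.
Qed.
End OfSeqs.

(** The canonical order of multinomials, by degree and then lexicographically, is the
order of the linear quotients. *)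
Definition power_exponents k : seq 'X_{1..r + l} :=
  sort <=%O [seq mnm_of_seqs (s, t) | s <- bounded_seqs r k,
                                      t <- bounded_seqs l (k - sumn s)].

Lemma mem_power_exponents k g : (g \in power_exponents k) = (mdeg g <= k).
Proof.
rewrite mem_sort; apply/allpairsPdep/idP => [[s [t []]]|gk].
  rewrite !mem_bounded_seqs => /andP[/eqP ss sk] /andP[/eqP st tk] ->.
  by rewrite mdeg_sides !side_deg_mnm_of_seqs //; lia.
have ss : size (seqs_of_mnm g).1 = r by rewrite size_map size_enum_ord.
have st : size (seqs_of_mnm g).2 = l by rewrite size_map size_enum_ord.
have gE : g = mnm_of_seqs ((seqs_of_mnm g).1, (seqs_of_mnm g).2).
  by rewrite [LHS](esym (seqs_of_mnmK g)).
have := side_deg_mnm_of_seqs ss st; rewrite -gE => dE.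
move: gk; rewrite mdeg_sides !dE => gk.
exists (seqs_of_mnm g).1, (seqs_of_mnm g).2.
by rewrite !mem_bounded_seqs ss st !eqxx !andTb; split; [lia|lia|exact: gE].
Qed.

Lemma power_exponents_uniq k : uniq (power_exponents k).
Proof.
rewrite sort_uniq; apply: allpairs_uniq_dep.
- exact: bounded_seqs_uniq.
- by move=> s _; apply: bounded_seqs_uniq.
move=> [s t] [s' t'] /allpairsPdep[x [y []]].
rewrite !mem_bounded_seqs => /andP[/eqP sx _] /andP[/eqP sy _] [-> ->].
case/allpairsPdep=> [x' [y' []]].
rewrite !mem_bounded_seqs => /andP[/eqP sx' _] /andP[/eqP sy' _] [-> ->] /= e.
have := congr1 seqs_of_mnm e; rewrite !mnm_of_seqsK //.
by case=> -> ->.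
Qed.

Lemma sum_power_exponents k i :
  \sum_(g <- power_exponents k) 'C(size (colon_vars g), i) = span_sum i r l k.
Proof.
rewrite (perm_big _ (permEl (perm_sort _ _))) big_allpairs_dep /=.
rewrite /span_sum; apply: eq_big_seq => s; rewrite mem_bounded_seqs => /andP[/eqP ss _].
apply: eq_big_seq => t; rewrite mem_bounded_seqs => /andP[/eqP st _].
by rewrite size_colon_vars.
Qed.

Lemma power_exponents_prefix k s1 g s2 h :
  power_exponents k = s1 ++ g :: s2 -> (h \in s1) = (h < g)%O.
Proof.
move=> e; have srt : sorted <=%O (power_exponents k) by apply: sort_le_sorted.
have unq := power_exponents_uniq k.
have : sorted <%O (power_exponents k) by rewrite lt_sorted_uniq_le unq.
rewrite {1}e lt_sorted_pairwise pairwise_cat /= allrel_consr.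
case/and4P=> /andP[/allP s1g _] _ /allP gs2 _; apply/idP/idP => [/s1g //|hg].
have : h \in power_exponents k.
  rewrite mem_power_exponents (leq_trans (lemc_mdeg (ltW hg))) //.
  by rewrite -mem_power_exponents e mem_cat mem_head orbT.
rewrite e mem_cat => /orP[//|]; rewrite inE => /orP[/eqP hE|/gs2 gh].
  by move: hg; rewrite hE ltxx.
by have := lt_trans hg gh; rewrite ltxx.
Qed.

Lemma whisker_power_lin_res (K : fieldType) k :
  lin_res (ideal_pow (edge_ideal K G) k) (k + k) (fun i => span_sum i r l k).
Proof.
have res : lin_res (mon_span (K := K)
    (fun m => has (fun g => power_monomial k g <= m)%MM (power_exponents k))) (k + k)
    (fun i => \sum_(g <- power_exponents k) 'C(size (colon_vars g), i)).
  apply: linear_quotients => [g|s1 g s2 e m].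
    rewrite mem_power_exponents => gk; split; last exact: colon_vars_uniq.
    exact: mdeg_power_monomial.
  have gk : mdeg g <= k.
    by rewrite -mem_power_exponents e mem_cat mem_head orbT.
  apply/hasP/idP => [[h hs1 hm]|/(power_monomial_colon m gk)[h hg hm]].
    apply/(power_monomial_colon m gk); exists h => //.
    by rewrite -(power_exponents_prefix h e).
  by exists h; rewrite ?(power_exponents_prefix h e).
apply: lin_res_ext res => [f|i]; last exact: sum_power_exponents.
rewrite edge_ideal_pow_mon_span; apply: mon_span_ext => m.
rewrite edge_product_whisker; split=> [/hasP[g]|[g [gk gm]]].
  by rewrite mem_power_exponents => gk gm; exists g.
by apply/hasP; exists g; rewrite ?mem_power_exponents.
Qed.

End WhiskerPowers.

Theorem theorem4p5 (K : fieldType) (r l k : nat) (hk : (1 <= k)%N) :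
  is_pd (ideal_pow (edge_ideal K (whisker r l)) k)
        (if (2 <= k)%N then (r + l)%N else maxn r l) /\
  is_betti (ideal_pow (edge_ideal K (whisker r l)) k)
    (fun i : nat =>
       if (1 <= i)%N then
         ('C(k + i - 2, i) * 'C(r + l + k, k + i)
          + 'C(k + i - 2, i - 1) * ('C(r + k, k + i) + 'C(l + k, k + i)))%N
       else 'C(r + l + k, k)).
Proof.
have [F [resF minF rkF]] := lin_res_graded (whisker_power_lin_res r l K k).
set beta := fun i : nat => _.
have rkE i : gc_rank F i = beta i.
  rewrite rkF /beta; case: i => [|i] /=; first exact: span_sum_index0.
  have kE : k.-1.+1 = k by rewrite prednK.
  rewrite -[in LHS]kE span_sum_closed kE subn1.
  have -> : (k + i.+1 - 2 = k.-1 + i)%N by lia.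
  by have -> : (k.-1 + i.+2 = k + i.+1)%N by lia.
split; last exact: minimal_rank_betti resF minF rkE.
apply: (minimal_resolution_pd resF minF) => [|i]; rewrite rkE /beta {beta rkE}.
  case: (ltnP 1 k) => hk2.
    case: (posnP (r + l)) => [_|hrl]; first by rewrite bin_gt0; lia.
    rewrite addn_gt0 muln_gt0 !bin_gt0; apply/orP; left; apply/andP; split; lia.
  have -> : k = 1%N by lia.
  case: (posnP (maxn r l)) => [_|hrl]; first by rewrite bin_gt0; lia.
  rewrite addn_gt0 [X in _ || X]muln_gt0 !addn_gt0 !bin_gt0.
  apply/orP; right; apply/andP; split; first by lia.
  by apply/orP; case: (leqP r l) => rl; [right|left]; lia.
case: (ltnP 1 k) => hk2 hi; rewrite (leq_ltn_trans (leq0n _) hi).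
  by rewrite !['C(_, k + i)]bin_small ?muln0 //; lia.
have -> : k = 1%N by lia.
by rewrite ['C(_ - _, i)]bin_small ?mul0n ?['C(_, 1 + i)]bin_small ?muln0 //; lia.
Qed.
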